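(* For every integer $\Delta\geq 5$, for all sufficiently large real $q$ and any real $\beta$ with $0<\beta\leq\beta_c$, w.h.p. over $G\sim \mathcal{G}_{n,\Delta}$, $G$ has WSM within the disordered phase at a radius $r$ which satisfies $r\leq \frac{1}{3}\log_{\Delta-1}n$.
   Context: For an integer $n$ with $\Delta n$ even, $\mathcal{G}_{n,\Delta}$ is the set of all $\Delta$-regular graphs with $n$ vertices, and $G\sim\mathcal{G}_{n,\Delta}$ denotes a uniformly random element. W.h.p. means with probability $1-o_n(1)$ as $n\to\infty$. Random cluster (RC) model: for a graph $G=(V,E)$ and reals $q,\beta>0$, configurations are maps $\mathcal{F}:E\to\{0,1\}$; $\Omega$ is the set of all configurations; $\mathrm{In}(\mathcal{F})$ is the set of edges mapped to $1$ (''in''), the others are ''out''; $c(\mathcal{F})$ is the number of connected components of $(V,\mathrm{In}(\mathcal{F}))$. The weight of $\mathcal{F}$ is $w_G(\mathcal{F})=q^{c(\mathcal{F})}(\mathrm{e}^\beta-1)^{|\mathrm{In}(\mathcal{F})|}$ and $\pi_G(\mathcal{F})=w_G(\mathcal{F})/\sum_{\mathcal{F}'\in\Omega}w_G(\mathcal{F}')$. The threshold $\beta_c=\beta_c(q,\Delta)$ is the ordered/disordered threshold on random $\Delta$-regular graphs, given (for $q>2$) by $\beta_c=\log\frac{q-2}{(q-1)^{1-2/\Delta}-1}$; it satisfies $\beta_c=(1+o_q(1))\frac{2\log q}{\Delta}$. Disordered phase: for an $n$-vertex $\Delta$-regular graph $G=(V,E)$ and $\epsilon>0$ let $\phi_G(\epsilon)=\min_{S\subseteq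 V;\,0<|S|\leq \epsilon n}\frac{|E(S,V\setminus S)|}{\Delta|S|}$. Fix $\delta=\delta(\Delta)\in(0,1/2)$ such that w.h.p. $G\sim\mathcal{G}_{n,\Delta}$ satisfies $\phi_G(1/2)\geq 1/10$ and $\phi_G(\delta)\geq 5/9$ (such $\delta$ is known to exist for $\Delta\ge5$), and let $\eta=\min(\delta/5,1/100)$. Then $\Omega^{\mathrm{dis}}=\{\mathcal{F}\in\Omega:|\mathrm{In}(\mathcal{F})|\leq\eta|E|\}$ and $\pi_G^{\mathrm{dis}}$ is $\pi_G$ conditioned on $\Omega^{\mathrm{dis}}$. WSM: $B_r(v)$ is the set of vertices at distance at most $r$ from $v$, and $E(B_r(v))$ is the set of edges with both endpoints in $B_r(v)$. $\pi_{\mathcal{B}_r^-(v)}$ is $\pi_G$ conditioned on all edges in $E\setminus E(B_r(v))$ being out. For an integer $r\geq1$, a graph $G$ with $m$ edges has WSM within the disordered phase at radius $r$ (for parameters $q,\beta$) if for every $v\in V(G)$ and every edge $e$ incident to $v$, $\|\pi_{\mathcal{B}_r^-(v)}(e\mapsto\cdot)-\pi_G^{\mathrm{dis}}(e\mapsto\cdot)\|_{\mathrm{TV}}\leq\frac{1}{100m}$, where $\mu(e\mapsto\cdot)$ denotes the marginal of $\mu$ on the state of $e$. *)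

(* Defs.v *)
From HB Require Import structures.
From mathcomp Require Import all_boot all_order all_algebra.
From mathcomp Require Import all_classical all_reals all_analysis.
Set Implicit Arguments.
Unset Strict Implicit.
Unset Printing Implicit Defensive.
Import Order.TTheory GRing.Theory Num.Theory.
Import numFieldNormedType.Exports.
Local Open Scope ring_scope.

(* A simple graph on V, given by its set of edges (2-element subsets of V). *)
Record sgraph (V : finType) := SGraph {
  edges :> {set {set V}};
  edges_card2 : [forall e in edges, #|e| == 2%N]
}.

HB.instance Definition _ (V : finType) := [isSub for @edges V].
HB.instance Definition _ (V : finType) := [Finite of sgraph V by <:].

Section Graphs.
Variable V : finType.

Definition adj (A : {set {set V}}) : rel V :=
  fun x y => [set x; y]%SET \in A.

Definition regular (Delta : nat) (G : sgraph V) : bool :=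
  [forall x, #|[set y | adj G x y]%SET| == Delta].

Definition graph_ball (G : sgraph V) (r : nat) (v : V) : {set V} :=
  [set u | [exists k : 'I_r.+1, [exists p : k.-tuple V,
              path (adj G) v p && (last v p == u)]]]%SET.

Definition edges_in (G : sgraph V) (B : {set V}) : {set {set V}} :=
  [set e in edges G | e \subset B]%SET.

Definition edge_cut (G : sgraph V) (S : {set V}) : {set {set V}} :=
  [set e in edges G |
    [exists x in S, [exists y in ~: S, e == [set x; y]]]]%SET.

(* The value is +oo when no nonempty S satisfies |S| <= eps |V|. *)
Definition expansion (R : realType) (Delta : nat) (G : sgraph V) (eps : R)
    : \bar R :=
  \big[Order.min/+oo%E]_(S : {set V}
      | (0 < #|S|)%N && (#|S|%:R <= eps * #|V|%:R))
    ((#|edge_cut G S|%:R / (Delta * #|S|)%:R)%:E).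

End Graphs.

Definition regular_graphs (Delta n : nat) : {set sgraph 'I_n} :=
  [set G | regular Delta G]%SET.

Definition prob_regular (R : realType) (Delta n : nat)
    (P : sgraph 'I_n -> Prop) : R :=
  #|[set G in regular_graphs Delta n | `[< P G >]]%SET|%:R
    / #|regular_graphs Delta n|%:R.

(* The limit is taken along the n with Delta * n even. For small such n there
   may be no Delta-regular graph, and then the probability is 0 / 0 = 0. *)
Definition whp (R : realType) (Delta : nat)
    (P : forall n, sgraph 'I_n -> Prop) : Prop :=
  (prob_regular R Delta (P n)
     @[n --> within [set n : nat | ~~ odd (Delta * n)] \oo] --> (1 : R))%classic.

Section FinitePmf.
Variables (R : realType) (T : finType).

Definition cond (mu : T -> R) (A : pred T) : T -> R :=
  fun x => if A x then mu x / \sum_(y | A y) mu y else 0.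

Definition tv_dist (mu nu : T -> R) : R :=
  2^-1 * \sum_x `|mu x - nu x|.

End FinitePmf.

Section RandomCluster.
Variables (R : realType) (V : finType) (G : sgraph V).

Definition edge_of := {e : {set V} | e \in edges G}.
Definition config := {ffun edge_of -> bool}.

Definition In_edges (F : config) : {set {set V}} :=
  [set val e | e : edge_of & F e]%SET.

Definition ncomp (F : config) : nat := n_comp (adj (In_edges F)) V.

Definition rc_weight (q beta : R) (F : config) : R :=
  q ^+ ncomp F * (expR beta - 1) ^+ #|In_edges F|.

Definition rc (q beta : R) (F : config) : R :=
  rc_weight q beta F / \sum_(F' : config) rc_weight q beta F'.

Definition disordered (eta : R) : pred config :=
  fun F => #|In_edges F|%:R <= eta * #|edges G|%:R.

Definition rc_dis (q beta eta : R) : config -> R :=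
  cond (rc q beta) (disordered eta).

Definition out_outside_ball (r : nat) (v : V) : pred config :=
  fun F => [forall e : edge_of,
    (val e \notin edges_in G (graph_ball G r v)) ==> ~~ F e].

Definition rc_ball (q beta : R) (r : nat) (v : V) : config -> R :=
  cond (rc q beta) (out_outside_ball r v).

Definition marginal (mu : config -> R) (e : edge_of) : bool -> R :=
  fun s => \sum_(F : config | F e == s) mu F.

Definition WSM_disordered (q beta eta : R) (r : nat) : Prop :=
  forall (v : V) (e : edge_of), v \in val e ->
    tv_dist (marginal (rc_ball q beta r v) e)
            (marginal (rc_dis q beta eta) e)
      <= (100 * #|edges G|%:R)^-1.

End RandomCluster.

(* The ordered/disordered threshold on random Delta-regular graphs, q > 2. *)
Definition beta_c (R : realType) (q : R) (Delta : nat) : R :=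
  ln ((q - 2) / ((q - 1) `^ (1 - 2 / Delta%:R) - 1)).

Definition admissible_delta (R : realType) (Delta : nat) (delta : R) : Prop :=
  0 < delta < 2^-1 /\
  whp R Delta (fun n (G : sgraph 'I_n) =>
    ((10^-1)%:E <= expansion Delta G (2^-1 : R))%E /\
    ((5 / 9)%:E <= expansion Delta G delta)%E).

Definition eta_of (R : realType) (delta : R) : R :=
  Num.min (delta / 5) (100^-1).

(* Main.v *)
Require Import Defs.
From mathcomp Require Import all_boot all_order all_algebra.
From mathcomp Require Import all_classical all_reals all_analysis.
From mathcomp Require Import zify ring lra.
From mathcomp Require Import fintype finset fingraph.

(** The proof compares the two measures of the statement by exchanging
    configurations. The random graph enters through its expansion at scale delta,
    and everything else is deterministic and holds for every large enough n.

    Take independent samples F1 from the measure on the ball of radius r around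
    v and F2 from the disordered measure, and let A be the cluster of v in the
    union of F1 and F2. No open edge of either leaves A, so exchanging F1 and F2
    on the edges that meet A preserves the product of their weights
    ([wt_swap]). If the exchanged pair is still admissible, that is if A lies in
    the ball and the new F2 is still disordered, the pair and its exchange
    cancel in the difference of the two marginals at an edge through v. Hence
    this difference is at most the probability that A has more than r + 1
    vertices or that F2 has nearly eta * #|edges G| open edges ([swap_defect],
    [swap_stays]).

    Both probabilities are small for the same reason. By expansion, or by the
    global bound on the number of edges when the cluster is larger than
    delta * n, every cluster S of an admissible configuration spans at most a
    4 / 9 proportion of the degrees D * #|S| ([disordered_sparse],
    [ball_sparse]). For beta <= beta_c one has exp(beta) ^ D <= 2 ^ D q ^ 2
    ([expR_beta_c]), so the weight of such a configuration, relative to the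
    empty one, is at most s ^ N, where N is the number of non-isolated vertices
    and s is as small as desired for q large ([wt_sparse]).

    A given set A is then the joint cluster with probability at most
    (4 ^ D s) ^ #|A| ([joint_cluster_prob]), and at most D ^ (2 k) connected sets
    with k vertices contain v ([card_clusters]); so a joint cluster of more than
    r + 1 vertices has probability polynomially small in n with an exponent that
    is large, because r is a fixed multiple of log n ([joint_cluster_tail]). A
    configuration with order n open edges has weight exponentially small in n,
    at a rate which for s small beats the number of all configurations
    ([disordered_tail]). *)

Set Implicit Arguments.
Unset Strict Implicit.
Unset Printing Implicit Defensive.
Import Order.TTheory GRing.Theory Num.Theory.
Import numFieldNormedType.Exports.

(** * Clusters of a relation *)

Local Open Scope set_scope.
Local Open Scope nat_scope.

Section Relations.
Variable V : finType.
Implicit Types (e : rel V) (A : {set V}).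

Definition support e : {set V} := [set x | [exists y, e x y]].

Definition rdeg e (x : V) : nat := #|[set y | e x y]|.

Definition cluster e (x : V) : {set V} := [set y | connect e x y].

Lemma rdeg_support e x : x \notin support e -> rdeg e x = 0.
Proof.
rewrite inE negb_exists => /forallP He; apply/eqP; rewrite cards_eq0.
by apply/eqP/setP => y; rewrite !inE (negbTE (He y)).
Qed.

(** A component with at least one edge contains a vertex that is not its root,
    so the non-root vertices, of which there are #|V| minus the number of
    components, make up at least half of the support. *)
Lemma ncomp_support e : symmetric e -> irreflexive e ->
  2 * n_comp e V + #|support e| <= 2 * #|V|.
Proof.
move=> sym_e irr_e; have csym := sym_connect_sym sym_e.
pose R := [set x | roots e x].
have -> : n_comp e V = #|R|.
  by apply: eq_card => x; rewrite !inE andbT.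
pose nb x := odflt x [pick y | e x y].
have nbP x : x \in support e -> e x (nb x).
  rewrite inE => /existsP[y exy]; rewrite /nb.
  by case: pickP => [z //|/(_ y)]; rewrite exy.
have rootnb x : x \in R :&: support e -> fingraph.root e (nb x) = x.
  case/setIP; rewrite inE => /eqP rx /nbP /connect1 c.
  by rewrite -[RHS]rx; apply/esym/(rootP csym).
(* The neighbours of the non-isolated roots are distinct non-roots. *)
have sub : nb @: (R :&: support e) \subset support e :\: R.
  apply/subsetP => _ /imsetP[x xRS ->]; rewrite inE.
  have /setIP[xR /nbP exn] := xRS.
  rewrite [nb x \in R]inE [nb x \in support e]inE /roots (rootnb x xRS); apply/andP; split.
    by apply/eqP => xn; rewrite -xn irr_e in exn.
  by apply/existsP; exists x; rewrite sym_e.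
have inj : {in R :&: support e &, injective nb}.
  by move=> x y /rootnb rx /rootnb ry Exy; rewrite -rx Exy ry.
have := subset_leq_card sub; rewrite card_in_imset // => le1.
have := cardsID R (support e); rewrite setIC => eq1.
have := cardsCs R; have : #|support e :\: R| <= #|~: R|.
  by apply/subset_leq_card/subsetP => x; rewrite !inE => /andP[].
have := cardsC R; have := max_card (mem R); lia.
Qed.

Lemma connect_restr e (A : {pred V}) : symmetric e -> closed e A ->
  forall x y, x \in A ->
  connect e x y = connect (fun x y => e x y && (x \in A)) x y.
Proof.
move=> sym_e cA x y xA; apply/idP/idP; last first.
  by apply: connect_sub => a b /andP[/connect1].
case/connectP => p; elim: p x xA => [|z p IH] x xA /=; first by move=> _ ->; apply: connect0.
case/andP => exz pp ly; apply: connect_trans (IH z _ pp ly).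
  by apply: connect1; rewrite exz.
by rewrite -(cA _ _ exz).
Qed.

Lemma n_comp_restr e (A : {set V}) : symmetric e -> closed e A ->
  n_comp (fun x y => e x y && (x \in A)) V = n_comp e A + #|~: A|.
Proof.
move=> sym_e cA; set eA := fun x y => _.
have root_out x : x \notin A -> fingraph.root eA x = x.
  move=> xA; have := connect_root eA x; case/connectP => -[|z p] /=; first by move=> _ ->.
  by rewrite /eA (negbTE xA) andbF.
have root_in x : x \in A -> fingraph.root eA x = fingraph.root e x.
  move=> xA; congr odflt; apply: eq_pick => y /=.
  by rewrite (connect_restr sym_e cA).
rewrite (n_compC (mem A)); congr (_ + _).
  by apply: eq_card => x; rewrite !inE /roots; case: (boolP (x \in A)) => [/root_in->|]; rewrite ?andbF.
apply: eq_card => x; rewrite !inE /roots; case: (boolP (x \in A)) => [|/root_out->]; rewrite ?andbF //=.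
by rewrite eqxx.
Qed.

(** Cutting a relation along a closed set turns the vertices of the other side
    into singletons, which accounts for the extra #|V|. This is what makes the
    random cluster weight multiplicative across a closed set. *)
Lemma n_comp_split e (A : {set V}) : symmetric e -> closed e A ->
  n_comp e V + #|V| = n_comp (fun x y => e x y && (x \in A)) V
                    + n_comp (fun x y => e x y && (x \notin A)) V.
Proof.
move=> sym_e cA; have cAC : closed e (~: A).
  by move=> x y /cA; rewrite !inE => ->.
have -> : n_comp (fun x y => e x y && (x \notin A)) V =
          n_comp (fun x y => e x y && (x \in ~: A)) V.
  by apply: eq_n_comp; apply: eq_connect => x y; rewrite inE.
rewrite !n_comp_restr // setCK (n_compC (mem A)).
have -> : n_comp e [predC A] = n_comp e (~: A) by apply: eq_n_comp_r => x; rewrite !inE.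
by rewrite -(cardsC A) [#|A| + _]addnC addnACA.
Qed.

Lemma cluster_closed e x : symmetric e -> closed e (cluster e x).
Proof.
move=> sym_e a b eab; rewrite !inE; exact: (connect_closed (sym_connect_sym sym_e) x).
Qed.

Lemma cluster_support e x y : symmetric e -> y \in cluster e x -> y != x ->
  cluster e x \subset support e.
Proof.
move=> sym_e; rewrite inE => cxy yx; apply/subsetP => z; rewrite inE => cxz.
have [w [wz czw]] : exists w, w != z /\ connect e z w.
  have [zx|zx] := eqVneq z x; first by exists y; rewrite zx.
  by exists x; rewrite eq_sym (sym_connect_sym sym_e).
case/connectP: czw => -[|u p] /=; first by move=> _ wE; rewrite wE eqxx in wz.
by case/andP => ezu _ _; rewrite inE; apply/existsP; exists u.
Qed.

Lemma card_cluster_support e x : symmetric e -> 1 < #|cluster e x| ->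
  cluster e x \subset support e.
Proof.
move=> sym_e; rewrite (cardD1 x) => /=.
have xx : x \in cluster e x by rewrite inE.
rewrite xx add1n ltnS => /card_gt0P[y]; rewrite inE /= => /andP[yx yc].
exact: cluster_support yc yx.
Qed.

(** Isolated vertices have degree zero, so a density bound that holds on every
    cluster can be summed over the clusters with an edge alone. *)
Lemma sum_deg_support e (c d : nat) : symmetric e -> irreflexive e ->
  (forall x, c * \sum_(y in cluster e x) rdeg e y <= d * #|cluster e x|) ->
  c * \sum_x rdeg e x <= d * #|support e|.
Proof.
move=> sym_e irr_e H; have csym := sym_connect_sym sym_e.
have -> : #|support e| = \sum_x (x \in support e) by rewrite -sum1_card big_mkcond.
rewrite (partition_big (fingraph.root e) (roots e)); last by move=> x _; apply: roots_root.
rewrite [X in _ <= _ * X](partition_big (fingraph.root e) (roots e)); last by move=> x _; apply: roots_root.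
rewrite !big_distrr /=; apply: leq_sum => r rr.
have E f : \sum_(i | true && (fingraph.root e i == r)) f i = \sum_(i in cluster e r) f i :> nat.
  apply: eq_bigl => x; rewrite inE /= eq_sym -{1}(eqP rr).
  by apply: root_connect.
rewrite !E; case: (leqP #|cluster e r| 1) => [le1|gt1].
  have cr x : x \in cluster e r -> x = r.
    move=> xc; have rc : r \in cluster e r by rewrite inE.
    by move/card_le1_eqP: le1; apply.
  suff -> : \sum_(y in cluster e r) rdeg e y = 0 by rewrite muln0.
  apply: big1 => y yc; apply: rdeg_support; rewrite inE.
  apply/existsP => -[z eyz].
  have zr : z = y.
    by rewrite (cr y yc); apply: cr; rewrite -(cluster_closed r sym_e eyz).
  by rewrite zr irr_e in eyz.
apply: leq_trans (H r) _; rewrite leq_mul2l; apply/orP; right.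
rewrite -sum1_card; apply: leq_sum => x xc.
by rewrite (subsetP (card_cluster_support sym_e gt1) x xc).
Qed.

End Relations.

(** * Walks and connected sets *)

Lemma card_bigcup_leq (I : finType) (T : finType) (P : {pred I}) (X : I -> {set T}) :
  #|\bigcup_(i in P) X i| <= \sum_(i in P) #|X i|.
Proof.
apply: (big_ind2 (fun (Y : {set T}) m => #|Y| <= m)) => //; first by rewrite cards0.
by move=> Y m Z m' hY hZ; apply: leq_trans (leq_card_setU Y Z) (leq_add hY hZ).
Qed.

Section Walks.
Variables (V : finType) (e : rel V) (D : nat).
Hypothesis sym_e : symmetric e.
Hypothesis reg_e : forall x, rdeg e x = D.

(** A numbering of the neighbours of each vertex: a walk of length k from a
    given vertex is then a word in 'I_D ^ k, and counting walks is counting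
    words. The default value x is never reached in a D-regular graph. *)
Definition port (x : V) (i : 'I_D) : V := nth x (enum [set y | e x y]) i.

Lemma path_ports v p : path e v p ->
  exists c : (size p).-tuple 'I_D, p = scanl port v c.
Proof.
elim: p v => [|y p IH] v /=; first by exists [tuple].
case/andP => evy /IH[c pE].
have yin : y \in enum [set y | e v y] by rewrite mem_enum inE.
have iD : index y (enum [set y | e v y]) < D.
  by rewrite -(reg_e v) /rdeg cardE index_mem.
exists [tuple of Ordinal iD :: c]; rewrite /= /port /= nth_index //.
by congr (_ :: _).
Qed.

(** Part of a cluster that a walk already covers has a neighbour y of some
    visited x outside it; the detour x, y, x adds one vertex for two steps. *)
Lemma covering_walk (f : rel V) v k : subrel f e -> k < #|cluster f v| ->
  exists p, [/\ path e v p, size p = 2 * k,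
    [set x in v :: p] \subset cluster f v & #|[set x in v :: p]| = k.+1].
Proof.
move=> fe; elim: k => [|k IH] kC.
  exists [::]; split=> //; last by rewrite -[RHS](cards1 v); apply: eq_card => x; rewrite !inE.
  by apply/subsetP => x; rewrite !inE => /eqP->; apply: connect0.
have [p [pp sp sub cp]] := IH (ltnW kC); set S := [set x in v :: p] in sub cp.
have [x [y [xS yS fxy]]] : exists x y, [/\ x \in S, y \notin S & f x y].
  have /subsetPn[z zC zS] : ~~ (cluster f v \subset S).
    by apply/negP => /subset_leq_card; rewrite cp leqNgt kC.
  move: zC; rewrite inE => /connectP[w].
  have : v \in S by rewrite inE mem_head.
  clearbody S.
  elim: w v {pp kC sub cp IH} => [|u w IHw] a aS /= => [_ zE|/andP[fau pw] lw].
    by rewrite zE aS in zS.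
  have [uS|uS] := boolP (u \in S); first exact: (IHw u).
  by exists a, u.
have yC : y \in cluster f v.
  have := subsetP sub x xS; rewrite !inE => c; exact: connect_trans c (connect1 fxy).
move: (xS); rewrite inE => /splitPl xp; move: pp sp xS yS sub cp; rewrite {}/S.
case: xp => p1 p2 lx; rewrite cat_path lx => /andP[pp1 pp2] sp xS yS sub cp.
exists (p1 ++ y :: x :: p2).
have SE : [set z in v :: p1 ++ y :: x :: p2] = y |: [set z in v :: p1 ++ p2].
  have xin : x \in v :: p1 by rewrite -lx mem_last.
  apply/setP => z; rewrite !inE !mem_cat !inE.
  have [->|zy] := eqVneq z y; first by rewrite !orbT.
  have [zx|zx] := eqVneq z x; last by [].
  by move: xin; rewrite -zx inE => /orP[] ->; rewrite ?orbT.
split.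
- by rewrite cat_path lx pp1 /= pp2 andbT [e y x]sym_e (fe _ _ fxy).
- move: sp; rewrite !size_cat /=; lia.
- by rewrite SE subUset sub1set yC sub.
- by rewrite SE cardsU1 yS cp.
Qed.

(** The usual bound on lattice animals: a connected set with k + 1 vertices is
    the trace of a walk of length 2k. *)
Lemma card_clusters (F : {set {set V}}) v k :
  (forall A, A \in F -> #|A| = k.+1 /\ exists2 f, subrel f e & A = cluster f v) ->
  #|F| <= D ^ (2 * k).
Proof.
move=> HF.
pose trace (c : (2 * k).-tuple 'I_D) : {set V} := [set x in v :: scanl port v c].
suff sub : F \subset trace @: setT.
  apply: leq_trans (subset_leq_card sub) _; apply: leq_trans (leq_imset_card _ _) _.
  by rewrite cardsT card_tuple card_ord.
apply/subsetP => A /HF[cA [f fe AE]].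
have [|p [pp sp sub cp]] := covering_walk (k := k) (v := v) fe; first by rewrite -AE cA.
have [c pE] := path_ports pp; rewrite sp in c pE; apply/imsetP; exists c => //.
rewrite /trace -pE; apply/esym/eqP.
by rewrite eqEcard AE sub cp -AE cA /=.
Qed.

Lemma card_ball r v (B : {set V}) : 0 < D ->
  (forall u, u \in B -> exists p, [/\ path e v p, size p <= r & last v p = u]) ->
  #|B| <= r.+1 * D ^ r.
Proof.
move=> D0 HB.
pose reach (k : 'I_r.+1) : {set V} := [set last v (scanl port v c) | c : k.-tuple 'I_D].
have sub : B \subset \bigcup_k reach k.
  apply/subsetP => u /HB[p [pp sp <-]]; have [c ->] := path_ports pp.
  by apply/bigcupP; exists (Ordinal (sp : size p < r.+1)) => //; apply: imset_f.
apply: leq_trans (subset_leq_card sub) _.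
apply: leq_trans (card_bigcup_leq _ _) _.
rewrite -[X in _ <= X * _](card_ord r.+1) -sum_nat_const; apply: leq_sum => k _.
apply: leq_trans (leq_imset_card _ _) _; rewrite card_tuple card_ord.
by rewrite leq_pexp2l // -ltnS.
Qed.

End Walks.

Lemma cluster_path (V : finType) (f : rel V) v x : x \in cluster f v ->
  exists p, [/\ path f v p, size p < #|cluster f v| & last v p = x].
Proof.
rewrite inE => /connectP[p /shortenP[p' pp' up' _] ->]; exists p'; split=> //.
rewrite -[_.+1]/(size (v :: p')) -(card_uniqP up').
apply/subset_leq_card/subsetP => y yp; rewrite inE.
by apply: (path_connect pp').
Qed.

(** * Degrees and edge cuts *)

Section EdgeSets.
Variable V : finType.
Implicit Types (E : {set {set V}}) (S A : {set V}).

Lemma adj_sym E : symmetric (adj E).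
Proof. by move=> x y; rewrite /adj setUC. Qed.

Definition loopless E := [forall f in E, #|f| == 2].

Lemma adj_irr E : loopless E -> irreflexive (adj E).
Proof.
move=> /forallP E2 x; apply/negP => xE; have := E2 [set x; x].
by move: xE; rewrite /adj => ->; rewrite cards2 eqxx.
Qed.

Lemma other_end E f x : loopless E -> f \in E -> x \in f ->
  exists2 y, x != y & f = [set x; y].
Proof.
move=> /forallP/(_ f)/implyP E2 fE xf; have /cards2P[a [b [ab fab]]] := E2 fE.
move: xf; rewrite fab !inE => /orP[]/eqP->; first by exists b.
by exists a; rewrite 1?eq_sym // setUC.
Qed.

Lemma rdeg_adj E x : loopless E -> rdeg (adj E) x = #|[set f in E | x \in f]|.
Proof.
move=> E2; rewrite /rdeg -(card_in_imset (f := fun y => [set x; y])); last first.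
  move=> y z; rewrite !inE => yE zE Eyz.
  have : y \in [set x; z] by rewrite -Eyz !inE eqxx orbT.
  rewrite !inE => /orP[/eqP yx|/eqP//].
  by have := adj_irr E2 x; rewrite -{2}yx yE.
apply: eq_card => f; rewrite inE; apply/imsetP/andP => [[y]|[fE xf]].
  by rewrite inE => yE ->; rewrite !inE eqxx.
have [y xy fxy] := other_end E2 fE xf.
by exists y; rewrite // inE /adj -fxy.
Qed.

Lemma handshake E : loopless E -> \sum_x rdeg (adj E) x = 2 * #|E|.
Proof.
move=> E2; under eq_bigr => x _ do rewrite (rdeg_adj x E2) -sum1_card big_mkcond.
rewrite exchange_big /= (bigID (mem E)) /= addnC big1 ?add0n; last first.
  by move=> f fE; apply: big1 => x _; rewrite inE (negbTE fE).
rewrite mulnC -sum_nat_const; apply: eq_bigr => f fE.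
have /implyP/(_ fE)/eqP <- := forallP E2 f; rewrite -sum1_card big_mkcond /= [RHS]big_mkcond /=.
by apply: eq_bigr => x _; rewrite inE fE /=.
Qed.

Lemma edges_meeting E A : loopless E ->
  #|[set f in E | ~~ [disjoint f & A]]| <= \sum_(x in A) rdeg (adj E) x.
Proof.
move=> E2; under eq_bigr => x _ do rewrite (rdeg_adj x E2).
apply: leq_trans (card_bigcup_leq _ _); apply/subset_leq_card/subsetP => f.
rewrite inE => /andP[fE /pred0Pn[x /andP[/= xf xA]]].
by apply/bigcupP; exists x => //; rewrite inE fE.
Qed.

Lemma card_edge_cut (G : sgraph V) S :
  #|edge_cut G S| <= \sum_(x in S) #|[set y | adj G x y && (y \notin S)]|.
Proof.
apply: leq_trans (_ : #|\bigcup_(x in S)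
    [set [set x; y] | y in [set y | adj G x y && (y \notin S)]]| <= _).
  apply/subset_leq_card/subsetP => f; rewrite inE => /andP[fE].
  case/exists_inP => x xS /exists_inP[y]; rewrite inE => yS /eqP fxy.
  apply/bigcupP; exists x => //; apply/imsetP; exists y => //.
  by rewrite inE yS /adj -fxy fE.
apply: leq_trans (card_bigcup_leq _ _) _; apply: leq_sum => x _.
exact: leq_imset_card.
Qed.

(** In a D-regular graph the edges leaving S use up at least a proportion
    a / (a + b) of the degrees in S, and what remains inside S bounds the degrees of any
    subgraph that does not leave S. *)
Lemma inner_degree (G : sgraph V) (D a b : nat) (f : rel V) S :
  (forall x, rdeg (adj G) x = D) -> subrel f (adj G) -> closed f S ->
  a * (D * #|S|) <= (a + b) * #|edge_cut G S| ->
  (a + b) * \sum_(x in S) rdeg f x <= b * (D * #|S|).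
Proof.
move=> regG fG cS cut.
have split x : rdeg (adj G) x =
    #|[set y | adj G x y && (y \in S)]| + #|[set y | adj G x y && (y \notin S)]|.
  rewrite /rdeg -(cardsID S); congr (_ + _).
    by apply: eq_card => y; rewrite !inE.
  by apply: eq_card => y; rewrite !inE andbC.
have tot : D * #|S| = \sum_(x in S) #|[set y | adj G x y && (y \in S)]| +
    \sum_(x in S) #|[set y | adj G x y && (y \notin S)]|.
  rewrite -big_split /= mulnC -sum_nat_const; apply: eq_bigr => x _.
  by rewrite -split regG.
have inn : \sum_(x in S) rdeg f x <= \sum_(x in S) #|[set y | adj G x y && (y \in S)]|.
  apply: leq_sum => x xS; apply/subset_leq_card/subsetP => y; rewrite !inE => fxy.
  by rewrite (fG _ _ fxy) -(cS _ _ fxy).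
have := card_edge_cut G S; move: cut inn; rewrite tot.
set i := \sum_(x in S) #|[set y | adj G x y && (y \in S)]|.
set o := \sum_(x in S) #|[set y | adj G x y && (y \notin S)]|.
set u := \sum_(x in S) rdeg f x; set c := #|edge_cut G S| => H ui co.
have h1 : a * (i + o) <= (a + b) * o by apply: leq_trans H _; rewrite leq_mul2l co orbT.
have h2 : (a + b) * u <= (a + b) * i by rewrite leq_mul2l ui orbT.
apply: leq_trans h2 _; nia.
Qed.

End EdgeSets.

(** * Cutting and mixing configurations *)

Section Configurations.
Variables (V : finType) (G : sgraph V).
Implicit Types (F H : config G) (A : {set V}).

Definition cadj F : rel V := adj (In_edges F).

Definition empty_config : config G := [ffun=> false].

Definition meets A (e : edge_of G) : bool := ~~ [disjoint val e & A].

(** An edge that meets A without being contained in A belongs to neither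
    configuration when A is closed for both; putting it on the F side is then
    immaterial, and ensures that an edge through a vertex of A is exchanged
    even if it is absent from both. *)
Definition mix A F H : config G := [ffun e => if meets A e then F e else H e].

Definition subconfig F H : Prop := forall e, F e -> H e.

Lemma cadjP F x y : reflect (exists2 e : edge_of G, F e & val e = [set x; y]) (cadj F x y).
Proof.
apply: (iffP imsetP) => -[e]; first by rewrite inE => Fe ->; exists e.
by move=> Fe exy; exists e; rewrite // inE.
Qed.

Lemma loopless_edges : loopless (edges G).
Proof. exact: edges_card2. Qed.

Lemma In_edges_sub F : In_edges F \subset edges G.
Proof. by apply/subsetP => _ /imsetP[e _ ->]; apply: (valP e). Qed.

Lemma loopless_In F : loopless (In_edges F).
Proof.
apply/forall_inP => f /(subsetP (In_edges_sub F)) fG.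
by have /forall_inP/(_ f fG) := loopless_edges.
Qed.

Lemma cadj_sym F : symmetric (cadj F).
Proof. exact: adj_sym. Qed.

Lemma cadj_irr F : irreflexive (cadj F).
Proof. exact: adj_irr (loopless_In F). Qed.

Lemma cadj_adj F : subrel (cadj F) (adj G).
Proof. by move=> x y; apply: (subsetP (In_edges_sub F)). Qed.

Lemma card_In F : #|In_edges F| = #|[set e | F e]|.
Proof. exact: (card_imset _ val_inj). Qed.

Lemma meets_edge A (e : edge_of G) x y : val e = [set x; y] ->
  meets A e = (x \in A) || (y \in A).
Proof.
move=> exy; rewrite /meets -setI_eq0 exy; apply/set0Pn/orP => [[z]|].
  by rewrite !inE => /andP[/orP[]/eqP-> ->]; [left|right].
by case=> zA; [exists x|exists y]; rewrite !inE zA eqxx ?orbT.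
Qed.

Lemma cadj_mix A F H x y : closed (cadj F) A -> closed (cadj H) A ->
  cadj (mix A F H) x y = if x \in A then cadj F x y else cadj H x y.
Proof.
move=> cF cH; apply/cadjP/idP => [[e]|].
  rewrite ffunE => Me exy; move: Me; rewrite (meets_edge _ exy).
  case: (boolP (x \in A)) => [xA Fe|xA] /=; first by apply/cadjP; exists e.
  case: (boolP (y \in A)) => [yA Fe|yA He]; last by apply/cadjP; exists e.
  by rewrite -(cF x y) ?(negbTE xA) // in yA; apply/cadjP; exists e.
case: (boolP (x \in A)) => [xA|xA] /[dup] c /cadjP[e Fe exy]; exists e => //; rewrite ffunE (meets_edge _ exy).
  by rewrite xA.
by rewrite -(cH _ _ c) (negbTE xA).
Qed.

Lemma mix_closed A F H : closed (cadj F) A -> closed (cadj H) A ->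
  closed (cadj (mix A F H)) A.
Proof.
move=> cF cH x y; rewrite cadj_mix //; move: (cF x y) (cH x y).
by case: (x \in A) => F' H'; [exact: F'|exact: H'].
Qed.

Lemma cadj_empty x y : cadj empty_config x y = false.
Proof. by apply/negP => /cadjP[e]; rewrite ffunE. Qed.

Lemma In_empty : #|In_edges empty_config| = 0.
Proof. by rewrite card_In; apply: eq_card0 => e; rewrite !inE ffunE. Qed.

Lemma empty_closed A : closed (cadj empty_config) A.
Proof. by move=> x y; rewrite cadj_empty. Qed.

Lemma mix_mixl A F H K : mix A (mix A F H) K = mix A F K.
Proof. by apply/ffunP => e; rewrite !ffunE; case: (meets A e). Qed.

Lemma mix_mixr A F H K : mix A F (mix A H K) = mix A F K.
Proof. by apply/ffunP => e; rewrite !ffunE; case: (meets A e). Qed.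

Lemma ncomp_mix A F : closed (cadj F) A ->
  ncomp F + #|V| = ncomp (mix A F empty_config) + ncomp (mix A empty_config F).
Proof.
move=> cF; have c0 := @empty_closed A; rewrite /ncomp (n_comp_split (@adj_sym _ _) cF).
congr (_ + _); apply: eq_n_comp; apply: eq_connect => x y;
  by rewrite -!/(cadj _) cadj_mix // cadj_empty; case: ifP; rewrite ?andbT ?andbF.
Qed.

Lemma card_In_mix A F :
  #|In_edges F| = #|In_edges (mix A F empty_config)| + #|In_edges (mix A empty_config F)|.
Proof.
rewrite !card_In -(cardsID [set e | meets A e]); congr (_ + _).
  by apply: eq_card => e; rewrite !inE !ffunE; case: ifP; rewrite ?andbT ?andbF.
by apply: eq_card => e; rewrite !inE !ffunE; case: ifP.
Qed.

Variable D : nat.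
Hypothesis reg : forall x, rdeg (adj G) x = D.

Lemma card_edges : D * #|V| = 2 * #|edges G|.
Proof.
rewrite -(handshake loopless_edges) (eq_bigr (fun=> D)) => [|x _]; last exact: reg.
by rewrite sum_nat_const mulnC.
Qed.

(** Every edge that meets A is counted in the degree of a vertex of A. *)
Lemma card_meets A : #|[set e : edge_of G | meets A e]| <= D * #|A|.
Proof.
rewrite -(card_imset _ val_inj) mulnC -sum_nat_const.
rewrite -(eq_bigr _ (fun x _ => reg x)); apply: leq_trans (edges_meeting A loopless_edges).
apply/subset_leq_card/subsetP => _ /imsetP[e + ->]; rewrite !inE => me.
by rewrite (valP e).
Qed.

(** Every cluster S spans at most a 4 / 9 proportion of the degrees D * #|S|.
    With (e^beta - 1)^D of order q^2, the edges of a cluster with k vertices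
    then contribute at most about q^(4 k / 9), less than the loss q^(k - 1) in
    the number of components as soon as k is at least 2. *)
Definition sparse F : Prop := forall x,
  9 * \sum_(y in cluster (cadj F) x) rdeg (cadj F) y <= 4 * D * #|cluster (cadj F) x|.

Lemma sparse_In F : sparse F -> 9 * #|In_edges F| <= 2 * D * #|support (cadj F)|.
Proof.
move/(sum_deg_support (@cadj_sym F) (@cadj_irr F)).
rewrite (handshake (loopless_In F)); lia.
Qed.

Lemma ncomp_le F : ncomp F <= #|V|.
Proof. exact: max_card. Qed.

(** A configuration is determined by its erasure on A and by its values on the
    edges that meet A. *)
Lemma card_mix_fiber A H :
  #|[set F | mix A empty_config F == H]| <= 2 ^ (D * #|A|).
Proof.
apply: leq_trans (_ : 2 ^ #|[set e : edge_of G | meets A e]| <= _); last first.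
  by rewrite leq_pexp2l // card_meets.
rewrite -card_bool -(card_pffun_on false).
rewrite -(card_in_imset (f := fun F => mix A F empty_config)); last first.
  move=> F K; rewrite !inE => /eqP FH /eqP KH FK; apply/ffunP => e.
  have := congr1 (fun f : config G => f e) FK; have := congr1 (fun f : config G => f e) FH.
  by rewrite -KH /= !ffunE; case: (meets A e).
apply: subset_leq_card; apply/subsetP => _ /imsetP[F _ ->]; apply/pffun_onP; split=> //.
apply/subsetP => e; by rewrite !inE !ffunE; case: (meets A e).
Qed.

End Configurations.

(** * Weights of sparse configurations *)

Local Open Scope ring_scope.

Section Weights.
Variables (R : realType) (V : finType) (G : sgraph V) (q beta : R).
Hypotheses (q_gt0 : 0 < q) (beta_gt0 : 0 < beta).
Implicit Types (F H : config G) (A : {set V}).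

(** Dividing by the weight q ^ #|V| of the empty configuration makes the weight
    multiplicative over configurations that live on disjoint closed sets. *)
Definition wt F : R := rc_weight q beta F / q ^+ #|V|.

Lemma expB_gt0 : 0 < expR beta - 1.
Proof. by rewrite subr_gt0 expR_gt1. Qed.

Lemma wt_gt0 F : 0 < wt F.
Proof. by rewrite divr_gt0 ?mulr_gt0 ?exprn_gt0 ?expB_gt0. Qed.

Lemma wt_mix A F : closed (cadj F) A ->
  wt F = wt (mix A F (empty_config G)) * wt (mix A (empty_config G) F).
Proof.
move=> cF; rewrite /wt /rc_weight (card_In_mix A F) exprD.
have qn : q ^+ #|V| != 0 by rewrite expf_neq0 // gt_eqF.
have E := congr1 (fun k => q ^+ k) (ncomp_mix cF); rewrite /= !exprD in E.
have -> : q ^+ ncomp F = q ^+ ncomp (mix A F (empty_config G)) *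
    q ^+ ncomp (mix A (empty_config G) F) / q ^+ #|V| by rewrite -E mulfK.
have pairs (a b u v Q' : R) : a * b * Q' * (u * v) * Q' = a * u * Q' * (b * v * Q').
  by ring.
exact: pairs.
Qed.

Lemma wt_swap A F H : closed (cadj F) A -> closed (cadj H) A ->
  wt (mix A F H) * wt (mix A H F) = wt F * wt H.
Proof.
move=> cF cH; rewrite (wt_mix (mix_closed cF cH)) (wt_mix (mix_closed cH cF)).
rewrite !mix_mixl !mix_mixr (wt_mix cF) (wt_mix cH).
by rewrite mulrACA [RHS]mulrACA; congr (_ * _); apply: mulrC.
Qed.

Lemma wt_empty : wt (empty_config G) = 1.
Proof.
rewrite /wt /rc_weight In_empty.
have -> : ncomp (empty_config G) = #|V|.
  apply: eq_card => x; rewrite !inE andbT /roots; apply/eqP.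
  have := connect_root (adj (In_edges (empty_config G))) x.
  by case/connectP => -[|y p] //=; rewrite -/(cadj _) cadj_empty.
by rewrite expr0 mulr1 divff // expf_neq0 // gt_eqF.
Qed.

Variables (D : nat) (s : R).
Hypotheses (s_gt0 : 0 < s).
Hypothesis q_large : 16 ^+ D <= s ^+ 18 * q.
Hypothesis beta_small : expR beta ^+ D <= 2 ^+ D * q ^+ 2.
Hypothesis q_ge1 : 1 <= q.

(** Raised to the power 18 the claim only involves integer powers. With N the
    size of the support, sparsity gives at most 2 D N / 9 edges, hence an edge
    factor of at most (2 ^ D q ^ 2) ^ (4 N) = 16 ^ (D N) q ^ (8 N), while at
    least N / 2 components are lost, hence a factor q ^ (- 9 N). One power
    q ^ (- N) is left to absorb 16 ^ (D N) and to produce the decay. *)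
Lemma wt_sparse F : sparse D F -> wt F <= s ^+ #|support (cadj F)|.
Proof.
move=> /sparse_In sF; set N := #|support _| in sF *; set m := #|In_edges F| in sF.
have cN : (2 * ncomp F + N <= 2 * #|V|)%N.
  by apply: ncomp_support; [apply: cadj_sym | apply: cadj_irr].
have [s0 w0] : 0 <= s /\ 0 <= wt F by rewrite !ltW ?wt_gt0.
rewrite -(@ler_pXn2r _ 18) ?nnegrE ?(exprn_ge0 N s0) //.
have qk k : 0 < q ^+ k by rewrite exprn_gt0.
have -> : wt F = (expR beta - 1) ^+ m / q ^+ (#|V| - ncomp F).
  rewrite /wt /rc_weight -/m -[X in _ / q ^+ X](subnK (ncomp_le F)) exprD.
  by rewrite [X in X / _]mulrC -mulf_div divff ?mulr1 // gt_eqF.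
rewrite expr_div_n ler_pdivrMr ?exprn_gt0 // -!exprM.
apply: le_trans (_ : expR beta ^+ (m * 18) <= _).
  by apply: lerXn2r; rewrite ?nnegrE ?expR_ge0 ?(ltW expB_gt0) // gerBl.
apply: le_trans (_ : expR beta ^+ (D * (4 * N)) <= _).
  by apply: ler_weXn2l; [rewrite ltW // expR_gt1 | lia].
rewrite exprM.
apply: le_trans (_ : (2 ^+ D * q ^+ 2) ^+ (4 * N) <= _).
  by apply: lerXn2r; rewrite ?nnegrE ?exprn_ge0 ?expR_ge0 ?mulr_ge0 ?exprn_ge0 // (ltW q_gt0).
have -> : (2 ^+ D * q ^+ 2) ^+ (4 * N) = (16 ^+ D) ^+ N * q ^+ (8 * N) :> R.
  rewrite exprMn -!exprM; congr (_ * q ^+ _); last by lia.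
  have -> : 16 = 2 ^+ 4 :> R by rewrite -natrX.
  by rewrite -exprM; congr (_ ^+ _); lia.
apply: le_trans (_ : (s ^+ 18 * q) ^+ N * q ^+ (8 * N) <= _).
  by rewrite ler_wpM2r ?(ltW (qk _)) // lerXn2r // nnegrE ?mulr_ge0 ?exprn_ge0 // ltW.
rewrite exprMn -exprM -mulrA -exprD mulnC ler_pM2l ?exprn_gt0 //.
by apply: ler_weXn2l => //; lia.
Qed.

End Weights.

(** * Comparing two conditional measures by a swap *)

Section Conditioning.
Variables (R : realType) (T : finType) (w : T -> R).
Hypothesis w_gt0 : forall x, 0 < w x.
Implicit Types P : pred T.

Lemma cond_ge0 P x : 0 <= cond w P x.
Proof.
rewrite /cond; case: ifP => // _; apply: divr_ge0; first exact: ltW.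
by apply: sumr_ge0 => y _; rewrite ltW.
Qed.

Lemma sum_pos P x : P x -> 0 < \sum_(y | P y) w y.
Proof.
move=> Px; rewrite (bigD1 x) //= ltr_wpDr //.
by apply: sumr_ge0 => y _; rewrite ltW.
Qed.

Lemma sum_cond P x : P x -> \sum_y cond w P y = 1.
Proof.
move=> Px; rewrite /cond -big_mkcond /= -mulr_suml divff // gt_eqF //.
exact: sum_pos Px.
Qed.

Lemma cond_scale P c : c != 0 -> cond (fun x => w x * c) P =1 cond w P.
Proof.
move=> c0 x; rewrite /cond -mulr_suml; case: ifP => // _.
by rewrite -mulf_div divff ?mulr1.
Qed.

End Conditioning.

Section Swapping.
Variables (R : realType) (V : finType) (G : sgraph V) (q beta : R).
Hypotheses (q_gt0 : 0 < q) (beta_gt0 : 0 < beta).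
Variables (v : V) (P1 P2 : pred (config G)).
Local Notation config2 := (config G * config G)%type.
Implicit Type p : config2.

(** The cluster of v in the union of the two configurations. It is closed for
    both, so the two configurations may be exchanged on it. *)
Definition joint_cluster p : {set V} :=
  cluster (fun x y => cadj p.1 x y || cadj p.2 x y) v.

Definition swap p : config2 :=
  (mix (joint_cluster p) p.2 p.1, mix (joint_cluster p) p.1 p.2).

Lemma joint_closed p : closed (cadj p.1) (joint_cluster p) /\
  closed (cadj p.2) (joint_cluster p).
Proof.
have c : closed (fun x y => cadj p.1 x y || cadj p.2 x y) (joint_cluster p).
  by apply: cluster_closed => x y; rewrite !(cadj_sym _ x).
by split=> x y xy; apply: c; rewrite xy ?orbT.
Qed.

Lemma joint_swap p : joint_cluster (swap p) = joint_cluster p.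
Proof.
have [c1 c2] := joint_closed p.
apply/setP => x; rewrite !inE; apply: eq_connect => {}x y.
by rewrite /= !cadj_mix //; case: ifP => _ //; rewrite orbC.
Qed.

Lemma swapK : involutive swap.
Proof.
move=> p; rewrite {1}/swap joint_swap /= !mix_mixl !mix_mixr; case: p => F H /=.
by congr pair; apply/ffunP => e; rewrite ffunE; case: ifP.
Qed.

Local Notation w := (wt q beta).
Let mu1 := cond w P1.
Let mu2 := cond w P2.

(** Exchanging the two configurations on the joint cluster of v preserves the
    product weight and exchanges the states of the edge e through v. Pairs for
    which the exchanged pair is still admissible therefore contribute equally
    to both marginals, and only the other pairs can make them differ. *)
Lemma swap_defect (e : edge_of G) (b : bool) F0 :
  v \in val e -> P1 F0 -> P2 F0 ->
  `|marginal mu1 e b - marginal mu2 e b| <=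
  \sum_(p : config2 | ~~ (P1 (swap p).1 && P2 (swap p).2)) mu1 p.1 * mu2 p.2.
Proof.
move=> ve P1F P2F; have wp (F : config G) : 0 < w F by apply: wt_gt0.
have m1 := sum_cond wp P1F; have m2 := sum_cond wp P2F.
pose d p : R := (p.1 e == b)%:R - (p.2 e == b)%:R.
have -> : marginal mu1 e b - marginal mu2 e b = \sum_(p : config2) mu1 p.1 * mu2 p.2 * d p.
  rewrite -(pair_bigA _ (fun F H => mu1 F * mu2 H * d (F, H))) /= /d /=.
  under eq_bigr => F _.
    under eq_bigr => H _ do rewrite mulrBr.
    rewrite sumrB -[X in X - _]mulr_suml -mulr_sumr m2 mulr1.
    under [X in _ - X]eq_bigr => H _ do rewrite -mulrA.
    rewrite -mulr_sumr; over.
  rewrite sumrB -mulr_suml m1 mul1r /marginal; congr (_ - _).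
    by rewrite big_mkcond; apply: eq_bigr => F _; case: ifP; rewrite ?mulr1 ?mulr0.
  by rewrite big_mkcond; apply: eq_bigr => F _; case: ifP; rewrite ?mulr1 ?mulr0.
pose good p := [&& P1 p.1, P2 p.2, P1 (swap p).1 & P2 (swap p).2].
have sw_e p : d (swap p) = - d p.
  have me : meets (joint_cluster p) e.
    by rewrite /meets; apply/pred0Pn; exists v; rewrite /= ve inE connect0.
  by rewrite /d /= !ffunE me opprB.
(* The swap is an involution of the good pairs that changes the sign of d. *)
have good0 : \sum_(p | good p) mu1 p.1 * mu2 p.2 * d p = 0.
  set S := (X in X = 0); have : S = - S; last first.
    by move/eqP; rewrite -subr_eq0 opprK -mulr2n mulrn_eq0 => /eqP.
  rewrite {1}/S (reindex_inj (inv_inj swapK)) /= /S -sumrN.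
  apply: eq_big => [p|p /and4P[g1 g2 g3 g4]].
    by rewrite /good swapK andbA [RHS]andbA [RHS]andbC; congr (_ && _); rewrite andbA.
  rewrite swapK in g3 g4.
  have [c1 c2] := joint_closed p.
  rewrite sw_e mulrN; congr (- (_ * _)); rewrite /mu1 /mu2 /cond g1 g2 g3 g4.
  rewrite mulrACA [RHS]mulrACA; congr (_ * _).
  by rewrite /= mulrC wt_swap.
rewrite (bigID good) /= good0 add0r; apply: le_trans (ler_norm_sum _ _ _) _.
have W0 p : 0 <= mu1 p.1 * mu2 p.2 by rewrite mulr_ge0 ?cond_ge0.
rewrite big_mkcond [leRHS]big_mkcond /=; apply: ler_sum => p _.
case: ifP; rewrite /good; last by case: ifP.
have [p1|p1] := boolP (P1 p.1); last by rewrite /mu1 /cond (negbTE p1) !mul0r normr0; case: ifP.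
have [p2|p2] := boolP (P2 p.2); last by rewrite /mu2 /cond (negbTE p2) mulr0 !mul0r normr0; case: ifP.
move=> /= ->; rewrite normrM ger0_norm ?W0 // ler_piMr // /d.
by case: (p.1 e == b); case: (p.2 e == b); rewrite ?subrr ?subr0 ?sub0r ?normrN ?normr0 ?normr1.
Qed.

End Swapping.

(** * Joint clusters are rarely large *)

Section ClusterTail.
Variables (R : realType) (V : finType) (G : sgraph V) (q beta : R).
Hypotheses (q_gt0 : 0 < q) (beta_gt0 : 0 < beta).
Variables (D : nat) (s : R).
Hypothesis reg : forall x, rdeg (adj G) x = D.
Hypotheses (s_gt0 : 0 < s) (s_le1 : s <= 1) (D_gt0 : (0 < D)%N).
Local Notation w := (wt q beta).
Local Notation empty := (empty_config G).

(** Stability under closing edges: the only property of the two conditioning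
    events that erasing a cluster requires. *)
Definition down_closed (P : pred (config G)) : Prop :=
  forall F H, subconfig F H -> P H -> P F.

Lemma mix_empty_sub A (F : config G) : subconfig (mix A F empty) F.
Proof. by move=> e; rewrite !ffunE; case: ifP. Qed.

Lemma empty_mix_sub A (F : config G) : subconfig (mix A empty F) F.
Proof. by move=> e; rewrite !ffunE; case: ifP. Qed.

Lemma w_gt0 (F : config G) : 0 < w F.
Proof. exact: wt_gt0. Qed.

(** Erasing the edges that meet A loses at most the factor counting the
    configurations with a given erasure. *)
Lemma sum_erased (P : pred (config G)) (A : {set V}) : down_closed P ->
  \sum_(F | P F) w (mix A empty F) <= 2 ^+ (D * #|A|) * \sum_(F | P F) w F.
Proof.
move=> dP; rewrite (partition_big (fun F => mix A empty F) P) /=; last first.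
  by move=> F; apply/dP/empty_mix_sub.
rewrite mulr_sumr; apply: ler_sum => H PH.
apply: le_trans (_ : \sum_(F in [set F | mix A empty F == H]) w H <= _).
  rewrite [leLHS]big_mkcond [leRHS]big_mkcond; apply: ler_sum => F _.
  rewrite inE; case: (P F) => /=; case: eqP => [E|_] //; rewrite ?E //.
  by rewrite ltW ?w_gt0.
rewrite sumr_const -[leLHS]mulr_natl ler_wpM2r ?(ltW (w_gt0 _)) // -natrX ler_nat.
exact: card_mix_fiber.
Qed.

Variables (v : V) (P1 P2 : pred (config G)).
Hypotheses (d1 : down_closed P1) (d2 : down_closed P2).
Hypotheses (P1e : P1 empty) (P2e : P2 empty).
Hypothesis s1 : forall F, P1 F -> w F <= s ^+ #|support (cadj F)|.
Hypothesis s2 : forall F, P2 F -> w F <= s ^+ #|support (cadj F)|.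
Let mu1 := cond w P1.
Let mu2 := cond w P2.

(** A Peierls argument. Split both configurations along A. Inside A their
    supports cover A, so the weights of the two inner parts multiply to at most
    s ^ #|A|; the outer parts are again admissible, and each comes from at most
    2 ^ (D * #|A|) configurations. *)
Lemma joint_cluster_prob (A : {set V}) : (1 < #|A|)%N ->
  \sum_(p | joint_cluster v p == A) mu1 p.1 * mu2 p.2 <= (4 ^+ D * s) ^+ #|A|.
Proof.
move=> A1.
set Z1 := \sum_(F | P1 F) w F; set Z2 := \sum_(F | P2 F) w F.
have Z1p : 0 < Z1 := sum_pos w_gt0 P1e; have Z2p : 0 < Z2 := sum_pos w_gt0 P2e.
apply: le_trans (_ : \sum_(p | P1 p.1 && P2 p.2)
   (s ^+ #|A| / (Z1 * Z2)) * (w (mix A empty p.1) * w (mix A empty p.2)) <= _).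
  rewrite [leLHS]big_mkcond [leRHS]big_mkcond /=; apply: ler_sum => -[F H] _ /=.
  have [c1 c2] := joint_closed v (F, H); rewrite /mu1 /mu2 /cond.
  have rhs0 : 0 <= (s ^+ #|A| / (Z1 * Z2)) * (w (mix A empty F) * w (mix A empty H)).
    apply: mulr_ge0; first by rewrite divr_ge0 ?exprn_ge0 ?mulr_ge0 // ltW.
    by rewrite mulr_ge0 // ltW ?w_gt0.
  case: eqP => [cA|_]; last by case: ifP.
  rewrite cA /= in c1 c2.
  have [PF|PF] := boolP (P1 F); last by rewrite mul0r.
  have [PH|PH] := boolP (P2 H); last by rewrite mulr0.
  rewrite /= -/Z1 -/Z2 mulf_div [leRHS]mulrAC ler_wpM2r ?invr_ge0 ?mulr_ge0 ?(ltW Z1p) ?(ltW Z2p) //.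
  rewrite (wt_mix beta q_gt0 c1) (wt_mix beta q_gt0 c2) mulrACA.
  apply: ler_wpM2r; first by rewrite mulr_ge0 // ltW ?w_gt0.
  apply: le_trans (_ : s ^+ #|support (cadj (mix A F empty))| *
                       s ^+ #|support (cadj (mix A H empty))| <= _).
    apply: ler_pM; rewrite ?(ltW (w_gt0 _)) //.
      by apply/s1/(d1 _ PF)/mix_empty_sub.
    by apply/s2/(d2 _ PH)/mix_empty_sub.
  rewrite -exprD; apply: ler_wiXn2l; rewrite ?(ltW s_gt0) //.
  apply: leq_trans (leq_card_setU _ _); apply/subset_leq_card/subsetP => x xA.
  have ce := @empty_closed _ G A.
  have /subsetP/(_ x) : A \subset support (fun x y => cadj F x y || cadj H x y).
    rewrite -cA; apply: card_cluster_support; last by rewrite -/(joint_cluster v (F, H)) cA.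
    by move=> a b /=; rewrite !(cadj_sym _ a).
  move=> /(_ xA); rewrite !inE => /existsP[y xy].
  by case/orP: xy => xy; apply/orP; [left|right]; apply/existsP; exists y;
     rewrite cadj_mix // xA.
rewrite -mulr_sumr.
rewrite -(pair_big P1 P2 (fun F H => w (mix A empty F) * w (mix A empty H))) /=.
rewrite -big_distrlr /=.
apply: le_trans (_ : s ^+ #|A| / (Z1 * Z2) *
   ((2 ^+ (D * #|A|) * Z1) * (2 ^+ (D * #|A|) * Z2)) <= _).
  apply: ler_wpM2l; first by rewrite divr_ge0 ?exprn_ge0 ?mulr_ge0 // ltW.
  by apply: ler_pM; rewrite ?sum_erased ?sumr_ge0 // => F _; rewrite ltW ?w_gt0.
rewrite [_ * Z1 * _]mulrACA [_ * (Z1 * Z2)]mulrC mulrA divfK; last by rewrite mulf_neq0 // gt_eqF.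
by rewrite -exprMn -natrM exprM -exprMn mulrC.
Qed.

(** A union bound over the possible joint clusters: there are at most
    D ^ (2 k) connected sets with k vertices through v, and the leading factor
    is the number of possible sizes k. *)
Lemma joint_cluster_tail L : (1 < L)%N -> D%:R ^+ 2 * (4 ^+ D * s) <= 1 ->
  \sum_(p | (L <= #|joint_cluster v p|)%N) mu1 p.1 * mu2 p.2
   <= #|V|.+1%:R * (D%:R ^+ 2 * (4 ^+ D * s)) ^+ L.
Proof.
move=> L1; set rho := 4 ^+ D * s; set th := _ * rho => th1.
have rho0 : 0 <= rho by rewrite mulr_ge0 ?exprn_ge0 // ltW.
have th0 : 0 <= th by rewrite mulr_ge0 ?exprn_ge0.
pose cls := [set joint_cluster v p | p in [set: config G * config G]].
rewrite (partition_big (joint_cluster v) (fun A => L <= #|A|)%N) //=.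
apply: le_trans (_ : \sum_(A : {set V} | (A \in cls) && (L <= #|A|)%N) rho ^+ #|A| <= _).
  rewrite [leLHS]big_mkcond [leRHS]big_mkcond; apply: ler_sum => A _.
  case: (leqP L #|A|) => LA; rewrite ?andbF ?andbT //.
  case: ifP => Acls; last first.
    rewrite big1 // => p /andP[_ /eqP cA]; move: Acls.
    by rewrite -cA imset_f // inE.
  apply: le_trans (joint_cluster_prob (leq_trans L1 LA)).
  rewrite [leLHS]big_mkcond [leRHS]big_mkcond; apply: ler_sum => p _ /=.
  have W0 : 0 <= mu1 p.1 * mu2 p.2 by rewrite mulr_ge0 ?cond_ge0 //; apply: w_gt0.
  by case: eqP => _; rewrite ?andbF ?andbT //; case: ifP.
rewrite (partition_big (fun A : {set V} => inord #|A| : 'I_#|V|.+1) predT) //=.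
apply: le_trans (_ : \sum_(k < #|V|.+1) th ^+ L <= _); last first.
  by rewrite sumr_const card_ord mulr_natl.
apply: ler_sum => k _.
case: (leqP L k) => Lk; last first.
  rewrite big1 ?exprn_ge0 // => A /andP[/andP[_ LA] /eqP Ak].
  by move: Lk; rewrite -Ak inordK ?ltnS ?max_card // ltnNge LA.
apply: le_trans (_ : th ^+ k <= _); last exact: ler_wiXn2l.
rewrite exprMn.
pose Ak := [set A in cls | #|A| == k].
apply: le_trans (_ : \sum_(A in Ak) rho ^+ k <= _).
  rewrite [leLHS]big_mkcond [leRHS]big_mkcond; apply: ler_sum => A _ /=.
  rewrite inE; case: (A \in cls) => //=; case: eqP => [E|_]; rewrite ?andbF ?andbT.
    have kA : #|A| = k by rewrite -E inordK // ltnS max_card.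
    by rewrite kA eqxx; case: ifP => // _; rewrite exprn_ge0.
  by case: ifP => // _; rewrite exprn_ge0.
rewrite sumr_const -[leLHS]mulr_natl ler_wpM2r ?exprn_ge0 // -exprM -natrX ler_nat.
case: k Lk @Ak => -[|k] kn /= Lk; first by rewrite leqn0 in Lk; rewrite (eqP Lk) in L1.
set F := finset _.
apply: leq_trans (_ : D ^ (2 * k) <= _)%N; last by rewrite leq_pexp2l // leq_mul2l /= leqnSn.
apply: (card_clusters (@adj_sym _ G) reg (v := v)).
move=> A; rewrite inE => /andP[/imsetP[p _ ->] /eqP->]; split=> //.
exists (fun x y => cadj p.1 x y || cadj p.2 x y) => //.
by move=> x y /orP[]; apply: cadj_adj.
Qed.

End ClusterTail.

(** * Expansion and the disordered phase *)

Section Expansion.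
Variables (R : realType) (V : finType) (G : sgraph V) (D : nat) (delta : R).
Hypothesis reg : forall x, rdeg (adj G) x = D.
Hypothesis D_gt0 : (0 < D)%N.
Hypothesis expand : ((5 / 9)%:E <= expansion D G delta)%E.

Lemma small_set_degree (F : config G) (S : {set V}) :
  closed (cadj F) S -> (0 < #|S|)%N -> #|S|%:R <= delta * #|V|%:R ->
  (9 * \sum_(x in S) rdeg (cadj F) x <= 4 * D * #|S|)%N.
Proof.
move=> cS S0 Sd; rewrite -mulnA; apply: (inner_degree (a := 5) reg) => //.
  exact: cadj_adj.
have : ((5 / 9)%:E <= (#|edge_cut G S|%:R / (D * #|S|)%:R : R)%:E)%E.
  apply: le_trans expand _; apply: bigmin_le_cond => //.
  by rewrite S0 Sd.
rewrite lee_fin ler_pdivlMr ?ltr0n ?muln_gt0 ?D_gt0 // => H.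
rewrite -(ler_nat R) !natrM; move: H; rewrite natrM; lra.
Qed.

(** Expansion controls the clusters with at most delta * #|V| vertices. A larger
    cluster has at most as many edges as the whole configuration, which is few
    compared with delta * #|V| because eta <= delta / 5. *)
Lemma disordered_sparse (eta : R) (F : config G) :
  eta <= delta / 5 -> disordered eta F -> sparse D F.
Proof.
move=> eta_le dF x; set S := cluster _ x.
have cS : closed (cadj F) S by apply/cluster_closed/cadj_sym.
have [Sd|Sd] := leP #|S|%:R (delta * #|V|%:R).
  apply: small_set_degree => //; apply/card_gt0P; exists x.
  by rewrite inE connect0.
have sumS : (\sum_(y in S) rdeg (cadj F) y <= 2 * #|In_edges F|)%N.
  rewrite -(handshake (loopless_In F)) [leqRHS](bigID (mem S)) /=.
  exact: leq_addr.
apply: leq_trans (_ : 9 * (2 * #|In_edges F|) <= _)%N; first by rewrite leq_mul2l sumS.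
rewrite -(ler_nat R) !natrM.
have E : D%:R * #|V|%:R = 2 * #|edges G|%:R :> R by rewrite -!natrM (card_edges reg).
have dF' : #|In_edges F|%:R <= eta * #|edges G|%:R := dF.
have E0 : 0 <= #|edges G|%:R :> R by [].
have h1 : eta * #|edges G|%:R <= delta / 5 * #|edges G|%:R by rewrite ler_wpM2r.
have h2 : D%:R * (delta * #|V|%:R) <= D%:R * #|S|%:R by rewrite ler_wpM2l // ltW.
have h3 : D%:R * (delta * #|V|%:R) = 2 * (delta * #|edges G|%:R).
  by rewrite mulrCA E mulrCA.
have h4 : 0 <= D%:R * #|S|%:R :> R by [].
have h5 : #|In_edges F|%:R <= delta * #|edges G|%:R / 5 by move: dF' h1; lra.
move: h2 h3 h4 h5; rewrite -!mulrA; lra.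
Qed.

Lemma ball_self r v : v \in graph_ball G r v.
Proof.
rewrite inE; apply/existsP; exists ord0; apply/existsP; exists [tuple].
by rewrite /= eqxx.
Qed.

Lemma cadj_ball r v (F : config G) x y : out_outside_ball r v F -> cadj F x y ->
  x \in graph_ball G r v.
Proof.
move=> /forallP oF /cadjP[e Fe exy]; have := oF e; rewrite Fe implybF negbK.
by rewrite inE exy subUset sub1set => /andP[_ /andP[]].
Qed.

(** A cluster with an edge stays inside the ball, which is small enough for the
    expansion hypothesis. *)
Lemma ball_sparse r v (F : config G) : #|graph_ball G r v|%:R <= delta * #|V|%:R ->
  out_outside_ball r v F -> sparse D F.
Proof.
move=> Bd oF x; set S := cluster _ x.
have xS : x \in S by rewrite inE connect0.
have S0 : (0 < #|S|)%N by apply/card_gt0P; exists x.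
apply: small_set_degree => //; first exact/cluster_closed/cadj_sym.
apply: le_trans Bd; rewrite ler_nat; have [S1|S1] := leqP #|S| 1.
  apply: leq_trans S1 _; apply/card_gt0P; exists v; exact: ball_self.
apply/subset_leq_card/subsetP => y /(subsetP (card_cluster_support (@cadj_sym _ G F) S1)).
by rewrite inE => /existsP[z]; apply: cadj_ball.
Qed.

End Expansion.

Lemma path_adj_ball (V : finType) (G : sgraph V) r v p : path (adj G) v p ->
  (size p <= r)%N -> last v p \in graph_ball G r v.
Proof.
move=> pp sp; rewrite inE; apply/existsP; exists (Ordinal (sp : size p < r.+1)%N).
by apply/existsP; exists (in_tuple p); rewrite /= pp eqxx.
Qed.

Lemma card_graph_ball (V : finType) (G : sgraph V) D r v :
  (forall x, rdeg (adj G) x = D) -> (0 < D)%N ->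
  (#|graph_ball G r v| <= r.+1 * D ^ r)%N.
Proof.
move=> reg D0; apply: (card_ball reg (v := v) D0) => u.
rewrite inE => /existsP[k /existsP[p /andP[pp /eqP lp]]].
by exists p; rewrite size_tuple -ltnS.
Qed.

Section Mixing.
Variables (R : realType) (V : finType) (G : sgraph V) (q beta : R).
Hypotheses (q_ge1 : 1 <= q) (beta_gt0 : 0 < beta).
Variables (D : nat) (t : R) (l : nat) (delta eta : R).
Hypothesis reg : forall x, rdeg (adj G) x = D.
Hypothesis D_gt0 : (0 < D)%N.
Hypothesis expand : ((5 / 9)%:E <= expansion D G delta)%E.
Hypotheses (t_gt0 : 0 < t) (t_le1 : t <= 1) (eta_gt0 : 0 < eta).
Hypotheses (eta_l : 1 <= eta * l%:R) (eta_delta : eta <= delta / 5).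
Hypothesis q_large : 16 ^+ D <= t ^+ l ^+ 18 * q.
Hypothesis beta_small : expR beta ^+ D <= 2 ^+ D * q ^+ 2.
Local Notation w := (wt q beta).
Local Notation n := #|V|.
Local Notation dis := (disordered eta : pred (config G)).
Local Notation empty := (empty_config G).

Let q_gt0 : 0 < q. Proof. exact: lt_le_trans q_ge1. Qed.
Let wp (F : config G) : 0 < w F. Proof. exact: wt_gt0. Qed.

Lemma dis_empty : dis empty.
Proof. by rewrite /disordered In_empty mulr_ge0 // ltW. Qed.

Lemma dis_down : down_closed dis.
Proof.
move=> F H FH; apply: le_trans; rewrite ler_nat !card_In.
by apply/subset_leq_card/subsetP => e; rewrite !inE; apply: FH.
Qed.

Lemma ball_down r v : down_closed (out_outside_ball (G := G) r v).
Proof.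
move=> F H FH /forallP oH; apply/forallP => e; apply/implyP => /(implyP (oH e)).
by apply: contra; apply: FH.
Qed.

Lemma ball_empty r v : out_outside_ball r v empty.
Proof. by apply/forallP => e; rewrite ffunE implybT. Qed.

(** With a number of edges of order #|V|, sparsity forces a support of size at
    least eta * #|V|, hence weight at most t ^ #|V|. Since t may be taken small
    this beats the crude count 2 ^ #|edges| of all configurations. *)
Lemma disordered_tail :
  \sum_(F | eta / 2 * #|edges G|%:R < #|In_edges F|%:R) cond w dis F
    <= 2 ^+ #|edges G| * t ^+ n.
Proof.
apply: le_trans (_ : \sum_(F : config G) t ^+ n <= _); last first.
  by rewrite sumr_const card_ffun card_bool card_sig -[leLHS]mulr_natl natrX.
rewrite big_mkcond; apply: ler_sum => F _.
have tn : 0 <= t ^+ n by rewrite exprn_ge0 // ltW.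
case: ifP => // Fl; rewrite /cond; case: ifP => // dF.
have spF := disordered_sparse reg D_gt0 expand eta_delta dF.
have Z1 : 1 <= \sum_(H | dis H) w H.
  rewrite -[leLHS](wt_empty G beta q_gt0) (bigD1 empty) ?dis_empty //= lerDl.
  by apply: sumr_ge0 => H _; rewrite ltW.
rewrite ler_pdivrMr ?(lt_le_trans ltr01) //.
apply: le_trans (_ : t ^+ n <= _); last by rewrite ler_peMr.
apply: le_trans (wt_sparse q_gt0 beta_gt0 _ q_large beta_small q_ge1 spF) _.
  exact: exprn_gt0.
rewrite -exprM; apply: ler_wiXn2l; rewrite ?(ltW t_gt0) //.
set N := #|support _|; rewrite -(ler_nat R) natrM.
have E : D%:R * n%:R = 2 * #|edges G|%:R :> R by rewrite -!natrM (card_edges reg).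
have : 9 * #|In_edges F|%:R <= 2 * D%:R * N%:R :> R.
  by rewrite -!natrM ler_nat; apply: sparse_In.
move=> H; have Dp : 0 < D%:R :> R by rewrite ltr0n.
have eE : 0 <= eta * #|edges G|%:R by rewrite mulr_ge0 // ltW.
have H1 : D%:R * (eta * n%:R) <= D%:R * N%:R by rewrite mulrCA E; move: H Fl eE; lra.
move: H1; rewrite ler_pM2l // => H1.
have l0 : 0 <= l%:R :> R by [].
apply: le_trans (_ : l%:R * (eta * n%:R) <= _); last by rewrite ler_wpM2l.
by rewrite mulrA [_ * eta]mulrC ler_peMl.
Qed.

Variable r : nat.
Hypothesis ball_small : forall v, #|graph_ball G r v|%:R <= delta * n%:R.
Hypothesis cluster_small : (D * r.+1)%:R <= eta / 2 * #|edges G|%:R.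
Hypothesis theta_le1 : D%:R ^+ 2 * (4 ^+ D * t ^+ l) <= 1.

(** A joint cluster of at most r + 1 vertices lies in the ball of radius r, so
    the exchange keeps the first configuration inside the ball; and it adds at
    most D * (r + 1) edges to the second, which remains disordered if it had
    room for them. *)
Lemma swap_stays v (p : config G * config G) :
  out_outside_ball r v p.1 -> (#|joint_cluster v p| <= r.+1)%N ->
  #|In_edges p.2|%:R <= eta / 2 * #|edges G|%:R ->
  out_outside_ball r v (swap v p).1 && dis (swap v p).2.
Proof.
move=> /forallP o1 cl I2; have [c1 c2] := joint_closed v p; apply/andP; split.
  apply/forallP => e; apply/implyP => eB; rewrite ffunE.
  case: ifP => me; last exact: (implyP (o1 e)).
  apply: contra eB => p2e; have /cards2P[x [y [_ exy]]] : #|val e| == 2%N.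
    by have /forall_inP := loopless_edges G; apply; apply: (valP e).
  have xy : cadj p.2 x y by apply/cadjP; exists e.
  have inB z : z \in joint_cluster v p -> z \in graph_ball G r v.
    move/cluster_path => [s [ps ss <-]]; apply: path_adj_ball; last first.
      by rewrite -ltnS; apply: leq_trans ss cl.
    by apply: sub_path ps => a b /orP[]; apply: cadj_adj.
  rewrite inE (valP e) exy subUset !sub1set !inB //.
    by rewrite -(c2 _ _ xy); move: me; rewrite (meets_edge _ exy) -(c2 _ _ xy) orbb.
  by move: me; rewrite (meets_edge _ exy) -(c2 _ _ xy) orbb.
rewrite /disordered /=.
have : (#|In_edges (mix (joint_cluster v p) p.1 p.2)| <= D * r.+1 + #|In_edges p.2|)%N.
  rewrite !card_In; apply: leq_trans (_ : #|[set e : edge_of G | meets (joint_cluster v p) e]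
     :|: [set e | p.2 e]| <= _)%N.
    apply/subset_leq_card/subsetP => e; rewrite !inE ffunE; by case: ifP.
  apply: leq_trans (leq_card_setU _ _) _; rewrite leq_add2r.
  by apply: leq_trans (card_meets reg _) _; rewrite leq_mul2l cl orbT.
rewrite -(ler_nat R) natrD => H; apply: le_trans H _; move: cluster_small I2; lra.
Qed.

Lemma marginal_close v (e : edge_of G) b : v \in val e ->
  `|marginal (cond w (out_outside_ball r v)) e b - marginal (cond w dis) e b|
   <= n.+1%:R * (D%:R ^+ 2 * (4 ^+ D * t ^+ l)) ^+ r.+2 + 2 ^+ #|edges G| * t ^+ n.
Proof.
move=> ve; set P1 := out_outside_ball r v.
have P1e : P1 empty := ball_empty r v.
apply: le_trans (swap_defect q_gt0 beta_gt0 b ve P1e dis_empty) _.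
have s0 : 0 < t ^+ l by rewrite exprn_gt0.
have s1 : t ^+ l <= 1 by rewrite exprn_ile1 // ltW.
have W0 p : 0 <= cond w P1 p.1 * cond w dis p.2.
  by apply: mulr_ge0; apply: cond_ge0.
apply: le_trans (lerD (joint_cluster_tail q_gt0 beta_gt0 reg s0 s1 D_gt0 v (P1 := P1)
  (P2 := dis) (L := r.+2) _ _ P1e dis_empty _ _ _ theta_le1) disordered_tail) => //.
- set tail := \sum_(F | _ < _) _.
  have -> : tail = \sum_(p | eta / 2 * #|edges G|%:R < #|In_edges p.2|%:R)
      cond w P1 p.1 * cond w dis p.2.
    rewrite -(pair_big predT (fun H => eta / 2 * #|edges G|%:R < #|In_edges H|%:R)
       (fun F H => cond w P1 F * cond w dis H)) /=.
    by rewrite -big_distrlr /= (sum_cond wp P1e) mul1r.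
  rewrite [leLHS]big_mkcond [X in _ <= X + _]big_mkcond [X in _ <= _ + X]big_mkcond -big_split /=.
  apply: ler_sum => p _; have [_|cl] := leqP r.+2 #|joint_cluster v p|.
    by case: ifP => _; case: ifP => _; rewrite ?lerDl ?addr_ge0.
  rewrite add0r; have [P1p|P1p] := boolP (P1 p.1); last first.
    by rewrite /cond (negbTE P1p) mul0r !if_same.
  case: ltP => [_|I2]; first by case: ifP.
  by rewrite swap_stays.
- exact: ball_down.
- exact: dis_down.
- move=> F PF; apply: (wt_sparse q_gt0 beta_gt0 s0 q_large beta_small q_ge1).
  exact: ball_sparse reg D_gt0 expand _ _ _ (ball_small v) PF.
- move=> F PF; apply: (wt_sparse q_gt0 beta_gt0 s0 q_large beta_small q_ge1).
  exact: disordered_sparse reg D_gt0 expand _ _ eta_delta PF.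
Qed.

End Mixing.

(** * The threshold and the choice of the radius *)

Section Threshold.
Variables (R : realType) (D : nat) (q beta : R).
Hypotheses (D5 : (5 <= D)%N) (q5 : 5 <= q) (beta_le : beta <= beta_c q D).

(** With a = (q - 1) ^ (1 - 2 / D) and b = (q - 1) ^ (2 / D), exp beta_c is
    (q - 2) / (a - 1), where a * b = q - 1 and a >= 2, so it is at most 2 b. *)
Lemma expR_beta_c : expR beta ^+ D <= 2 ^+ D * q ^+ 2.
Proof.
have D0 : D%:R != 0 :> R by rewrite pnatr_eq0 -lt0n (leq_trans _ D5).
have Dge : 5 <= D%:R :> R by rewrite ler_nat.
have [q1 q1_1] : 0 < q - 1 /\ 1 <= q - 1 by split; move: q5; lra.
set a := (q - 1) `^ (1 - 2 / D%:R); set b := (q - 1) `^ (2 / D%:R).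
have ab : a * b = q - 1.
  rewrite /a /b -powRD ?subrK ?powRr1 ?ltW //.
  by apply/implyP => _; rewrite gt_eqF.
have bD : b ^+ D = (q - 1) ^+ 2.
  rewrite -powR_mulrn ?powR_ge0 // /b -powRrM divfK //; exact: powR_mulrn 2 (ltW q1).
have a2 : 2 <= a.
  apply: le_trans (_ : (q - 1) `^ 2^-1 <= _).
    rewrite powR12_sqrt ?(ltW q1) // -(@ler_pXn2r _ 2) ?nnegrE ?sqrtr_ge0 // sqr_sqrtr ?(ltW q1) //.
    by move: q5; lra.
  apply: ler_powR => //; rewrite lerBrDr -lerBrDl ler_pdivrMr; last by move: Dge; lra.
  by move: Dge; lra.
have a0 : 0 < a by move: a2; lra.
have b0 : 0 <= b by rewrite powR_ge0.
have X0 : 0 < (q - 2) / (a - 1) by apply: divr_gt0; move: q5 a2; lra.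
have le2b : expR beta <= 2 * b.
  apply: le_trans (_ : expR (beta_c q D) <= _); first by rewrite ler_expR.
  rewrite /beta_c -/a lnK ?posrE // ler_pdivrMr; last by move: a2; lra.
  have : 2 * b <= a * b by rewrite ler_wpM2r.
  by rewrite mulrBr mulr1 -mulrA [b * a]mulrC ab; move: q5; lra.
apply: le_trans (_ : (2 * b) ^+ D <= _).
  by apply: lerXn2r; rewrite ?nnegrE ?expR_ge0 // mulr_ge0.
rewrite exprMn bD ler_wpM2l ?exprn_ge0 //.
by apply: lerXn2r; rewrite ?nnegrE ?(ltW q1) //; move: q5; lra.
Qed.

End Threshold.

Section WSM.
Variables (R : realType) (V : finType) (G : sgraph V) (q beta : R).
Hypotheses (q_ge1 : 1 <= q) (beta_gt0 : 0 < beta).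

(** The partition function cancels in a conditional measure. *)
Lemma rc_wt (P : pred (config G)) :
  cond (rc q beta) P = cond (wt q beta) P.
Proof.
have q0 : 0 < q by apply: lt_le_trans q_ge1.
set Z := \sum_(F : config G) rc_weight q beta F.
have Z0 : 0 < Z.
  apply: lt_le_trans (_ : rc_weight q beta (empty_config G) <= _).
    by rewrite mulr_gt0 ?exprn_gt0 ?expB_gt0.
  rewrite /Z (bigD1 (empty_config G)) //= lerDl; apply: sumr_ge0 => F _.
  by rewrite ltW // mulr_gt0 ?exprn_gt0 ?expB_gt0.
have qn : 0 < q ^+ #|V| by rewrite exprn_gt0.
have -> : @rc R V G q beta = fun F => wt q beta F * (q ^+ #|V| / Z).
  by apply: funext => F; rewrite /wt mulrA divfK // gt_eqF.
by apply: funext => F; rewrite cond_scale // mulf_neq0 ?invr_eq0 // gt_eqF.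
Qed.

Lemma wsm_of_marginals eta r c :
  (forall v (e : edge_of G) b, v \in val e ->
  `|marginal (cond (wt q beta) (out_outside_ball r v)) e b
     - marginal (cond (wt q beta) (disordered eta)) e b| <= c) ->
  c <= (100 * #|edges G|%:R)^-1 -> WSM_disordered G q beta eta r.
Proof.
move=> H cle v e ve; apply: le_trans cle.
rewrite /tv_dist /rc_ball /rc_dis !rc_wt big_bool /=.
by have := H v e true ve; have := H v e false ve; lra.
Qed.

End WSM.

Section Sizes.
Variables (R : realType) (D : nat).
Hypothesis D5 : (5 <= D)%N.

Let D0 : (0 < D)%N. Proof. exact: leq_trans D5. Qed.

(** The factor 4 in the exponent leaves room twice: the radius stays below a
    third of the logarithm to base D - 1, and the ball has at most sqrt n
    vertices. *)
Definition radius n := trunc_log (D ^ 4) n.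

Variable n : nat.
Hypotheses (n_large : (D ^ 4 <= n)%N).

Let n0 : (0 < n)%N. Proof. by apply: leq_trans n_large; rewrite expn_gt0 D0. Qed.
Let D4 : (1 < D ^ 4)%N. Proof. by rewrite (@leq_trans (5 ^ 4)) // leq_exp2r. Qed.

Lemma radius_ge1 : (1 <= radius n)%N.
Proof. by rewrite trunc_log_gt0 D4 prednK // (leq_trans _ D4). Qed.

Lemma radius_le : (radius n)%:R <= 3^-1 * (ln (n%:R : R) / ln (D%:R - 1)).
Proof.
have D1 : 1 < D%:R - 1 :> R.
  by have : 5 <= D%:R :> R by [rewrite ler_nat]; lra.
have lD : 0 < ln (D%:R - 1 : R) by rewrite ln_gt0.
rewrite mulrA ler_pdivlMr //.
have le1 : ln (D%:R - 1) <= ln D%:R :> R.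
  by rewrite ler_ln ?posrE ?gerBl ?ltr0n // (lt_trans ltr01).
have : 4 * (radius n)%:R * ln D%:R <= ln n%:R :> R.
  rewrite -natrM mulr_natl -lnXn ?ltr0n // -natrX ler_ln ?posrE ?ltr0n ?expn_gt0 ?D0 //.
  by rewrite ler_nat expnM trunc_logP.
have : (radius n)%:R * ln (D%:R - 1) <= (radius n)%:R * ln D%:R :> R by rewrite ler_wpM2l.
have : 0 <= (radius n)%:R * ln (D%:R - 1) :> R by rewrite mulr_ge0 // ltW.
by lra.
Qed.

(** r + 1 <= D ^ r, so the square is at most D ^ (4 r) <= n. *)
Lemma ball_sqr : (((radius n).+1 * D ^ radius n) ^ 2 <= n)%N.
Proof.
apply: leq_trans (trunc_logP D4 n0); rewrite -/(radius n).
rewrite -expnM [(4 * _)%N](_ : _ = (radius n * 2) * 2)%N; last by lia.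
rewrite expnM leq_exp2r // expnM expnSr expn1 leq_mul2r.
by rewrite ltn_expl ?orbT // (leq_trans _ D5).
Qed.

Lemma below_of_sqr (x : nat) (a : R) : 0 < a -> 1 <= a ^+ 2 * n%:R ->
  (x ^ 2 <= n)%N -> x%:R <= a * n%:R.
Proof.
move=> a0 an xn; rewrite -(@ler_pXn2r _ 2) ?nnegrE ?mulr_ge0 ?(ltW a0) //.
apply: le_trans (_ : n%:R <= _); first by rewrite -natrX ler_nat.
by rewrite exprMn expr2 mulrA ler_peMl.
Qed.

(** The factor 16 ^ D pays for the number of configurations, per vertex, and the
    power of D for the number of clusters, leaving D ^ (- 16) per vertex of a
    cluster. Over a cluster of size about the radius, this is n ^ (- 4). *)
Definition decay : R := (D%:R ^+ 18 * 16 ^+ D)^-1.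

Local Notation t := decay.

Lemma decay_gt0 : 0 < t.
Proof. by rewrite invr_gt0 mulr_gt0 ?exprn_gt0 ?ltr0n. Qed.

Lemma decay_le1 : t <= 1.
Proof.
by rewrite invf_le1 ?mulr_gt0 ?exprn_gt0 ?ltr0n // mulr_ege1 ?exprn_ege1 ?ler1n.
Qed.

Lemma cluster_rate_le (l : nat) : (0 < l)%N ->
  D%:R ^+ 2 * (4 ^+ D * t ^+ l) <= (D%:R ^+ 16)^-1.
Proof.
move=> l0; have Dp : 0 < D%:R :> R by rewrite ltr0n.
have [t0 t1] := (decay_gt0, decay_le1).
apply: le_trans (_ : D%:R ^+ 2 * (4 ^+ D * t) <= _).
  rewrite ler_wpM2l ?exprn_ge0 ?(ltW Dp) // ler_wpM2l ?exprn_ge0 //.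
  by rewrite -[leRHS]expr1 ler_wiXn2l // ltW.
apply: le_trans (_ : D%:R ^+ 2 * (16 ^+ D * t) <= _).
  rewrite ler_wpM2l ?exprn_ge0 ?(ltW Dp) // ler_wpM2r ?(ltW t0) //.
  by rewrite lerXn2r ?nnegrE // ler_nat.
rewrite /decay invfM [X in _ * X]mulrCA divff ?mulr1 ?expf_neq0 ?pnatr_eq0 //.
rewrite -[18%N]/(2 + 16)%N exprD invfM mulrA divff ?mul1r // expf_neq0 // gt_eqF //.
Qed.

Lemma cluster_rate_le1 (l : nat) : (0 < l)%N -> D%:R ^+ 2 * (4 ^+ D * t ^+ l) <= 1.
Proof.
move/cluster_rate_le => H; apply: le_trans H _.
by rewrite invf_le1 ?exprn_gt0 ?ltr0n // exprn_ege1 // (ler_nat _ 1).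
Qed.

(** Since n < D ^ (4 (r + 1)), the first term is at most 2 n * n ^ (- 4); the
    second is at most 8 ^ (- n) <= n ^ (- 3). The target is of order 1 / n. *)
Lemma error_small (l E : nat) : (0 < l)%N -> (2 * E = D * n)%N ->
  (150 * D <= n)%N ->
  n.+1%:R * (D%:R ^+ 2 * (4 ^+ D * t ^+ l)) ^+ (radius n).+2 + 2 ^+ E * t ^+ n
   <= (100 * E%:R)^-1.
Proof.
move=> l0 E2 nD; have [t0 t1] := (decay_gt0, decay_le1).
have Dp : 0 < D%:R :> R by rewrite ltr0n.
have D1 : 1 <= D%:R :> R by rewrite (ler_nat _ 1).
have np : 0 < n%:R :> R by rewrite ltr0n.
set th := _ * (_ * _).
have th_le : th <= (D%:R ^+ 16)^-1 := cluster_rate_le l0.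
have th0 : 0 <= th by rewrite !mulr_ge0 ?exprn_ge0 // ltW.
have th1 : th <= 1 := cluster_rate_le1 l0.
have b1 : n.+1%:R * th ^+ (radius n).+2 <= 2 * (n%:R ^+ 3)^-1.
  apply: le_trans (_ : (2 * n%:R) * (n%:R ^+ 4)^-1 <= _); last first.
    by rewrite -mulrA exprS invfM mulrA mulrA mulfK ?gt_eqF // [leRHS]mulrC.
  apply: ler_pM; rewrite ?exprn_ge0 //.
    by rewrite -natrM ler_nat; move: n0; lia.
  apply: le_trans (_ : th ^+ (radius n).+1 <= _); first exact: ler_wiXn2l.
  apply: le_trans (_ : (D%:R ^+ 16)^-1 ^+ (radius n).+1 <= _).
    by rewrite lerXn2r // nnegrE invr_ge0 exprn_ge0 // ltW.
  rewrite exprVn lef_pV2 ?posrE ?exprn_gt0 // -exprM.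
  rewrite -[16%N]/(4 * 4)%N [(4 * 4 * _)%N](_ : _ = 4 * (radius n).+1 * 4)%N; last by lia.
  rewrite [leRHS]exprM lerXn2r ?nnegrE ?exprn_ge0 //.
  by rewrite -natrX ler_nat expnM ltnW // trunc_log_ltn.
have b2 : 2 ^+ E * t ^+ n <= (n%:R ^+ 3)^-1.
  apply: le_trans (_ : 2 ^+ (D * n) * t ^+ n <= _).
    rewrite ler_wpM2r ?exprn_ge0 ?(ltW t0) // ler_weXn2l ?ler1n //; move: E2; lia.
  rewrite exprM -exprMn.
  apply: le_trans (_ : (8^-1) ^+ n <= _).
    rewrite lerXn2r ?nnegrE ?mulr_ge0 ?exprn_ge0 ?(ltW t0) //.
    rewrite /decay ler_pdivrMr ?mulr_gt0 ?exprn_gt0 //.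
    rewrite [leRHS]mulrC ler_pdivlMr //.
    have -> : 16 = 2 * 8 :> R by rewrite -natrM.
    rewrite exprMn [leRHS]mulrCA ler_wpM2l ?exprn_ge0 //.
    rewrite -[leLHS]mul1r ler_pM ?exprn_ege1 // -[leLHS]expr1 ler_weXn2l //.
    by rewrite ler1n.
  rewrite exprVn lef_pV2 ?posrE ?exprn_gt0 //.
  rewrite -!natrX ler_nat -[8%N]/(2 ^ 3)%N -expnM mulnC expnM leq_exp2r //.
  by rewrite ltnW // ltn_expl.
apply: le_trans (lerD b1 b2) _.
have E0 : 100 * E%:R = 50 * (D%:R * n%:R) :> R.
  have : 2 * E%:R = D%:R * n%:R :> R by rewrite -!natrM E2.
  by lra.
rewrite E0 -[X in _ + X]mul1r -mulrDl ler_pdivrMr ?exprn_gt0 //.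
rewrite mulrC ler_pdivlMr ?mulr_gt0 //.
have nD' : 150 * D%:R <= n%:R :> R by rewrite -natrM ler_nat.
have n1 : 1 <= n%:R :> R by rewrite ler1n.
rewrite exprSr expr2 !mulrA ler_wpM2r ?(ltW np) //.
apply: le_trans (_ : n%:R * 1 <= _); last by rewrite ler_wpM2l // ltW.
by move: nD'; lra.
Qed.

End Sizes.

(** * High probability *)

Section Probability.
Variables (R : realType) (D : nat).

Lemma prob_regular_le n (P Q : sgraph 'I_n -> Prop) :
  (forall G, regular D G -> P G -> Q G) -> prob_regular R D P <= prob_regular R D Q.
Proof.
move=> PQ; rewrite /prob_regular ler_wpM2r ?invr_ge0 // ler_nat.
apply/subset_leq_card/subsetP => G; rewrite !inE => /andP[rG /asboolP PG].
by rewrite rG; apply/asboolP/PQ.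
Qed.

Lemma prob_regular_le1 n (P : sgraph 'I_n -> Prop) : prob_regular R D P <= 1.
Proof.
rewrite /prob_regular; have [->|c0] := posnP #|regular_graphs D n|.
  by rewrite invr0 mulr0.
rewrite ler_pdivrMr ?ltr0n // mul1r ler_nat.
by apply/subset_leq_card/subsetP => G; rewrite inE => /andP[].
Qed.

Lemma whp_mono n0 (P Q : forall n, sgraph 'I_n -> Prop) :
  (forall n G, (n0 <= n)%N -> regular D G -> P n G -> Q n G) ->
  whp R D P -> whp R D Q.
Proof.
move=> PQ hP; apply: (squeeze_cvgr _ hP (@cvg_cst _ _ _ _ _)).
near=> n; rewrite prob_regular_le1 andbT; apply: prob_regular_le => G.
apply: PQ; near: n; apply: cvg_within; exact: nbhs_infty_ge.
Unshelve. all: by end_near. Qed.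

End Probability.

Theorem theorem6 (R : realType) (Delta : nat) (hDelta : (5 <= Delta)%N)
    (delta : R) (hdelta : admissible_delta Delta delta) :
  exists q0 : R, forall q : R, q0 <= q ->
    forall beta : R, 0 < beta -> beta <= beta_c q Delta ->
      whp R Delta (fun n (G : sgraph 'I_n) =>
        exists r : nat,
          [/\ (1 <= r)%N,
              r%:R <= 3^-1 * (ln (n%:R : R) / ln (Delta%:R - 1)) &
              WSM_disordered G q beta (eta_of delta) r]).
Proof.
case: hdelta => /andP[delta0 _] hexp.
have D0 : (0 < Delta)%N := leq_trans (isT : 0 < 5)%N hDelta.
set eta := eta_of delta.
have eta0 : 0 < eta by rewrite lt_min divr_gt0 //= invr_gt0.
have eta_delta : eta <= delta / 5 by rewrite ge_min lexx.
(* With s = t ^ l, a support of size eta * n costs s ^ (eta * n) <= t ^ n. *)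
pose l := (Num.bound eta^-1).+1.
have eta_l : 1 <= eta * l%:R.
  rewrite mulrC -ler_pdivrMr // mul1r ltW // (lt_le_trans (archi_boundP _)) //.
    by rewrite invr_ge0 ltW.
  by rewrite ler_nat.
set t : R := decay R Delta; have t0 : 0 < t by apply: decay_gt0.
(* The 5 serves the bound on exp beta_c, the ratio makes the weight of a sparse
   configuration at most t ^ l per vertex of its support. *)
exists (5 + 16 ^+ Delta / t ^+ l ^+ 18) => q q_ge beta beta0 beta_le.
have ratio0 : 0 < 16 ^+ Delta / t ^+ l ^+ 18 by rewrite divr_gt0 ?exprn_gt0.
have q5 : 5 <= q by move: q_ge ratio0; lra.
have q1 : 1 <= q by move: q5; lra.
have q_large : 16 ^+ Delta <= t ^+ l ^+ 18 * q.
  rewrite mulrC -ler_pdivrMr ?exprn_gt0 //; move: q_ge; lra.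
have beta_small := expR_beta_c hDelta q5 beta_le.
(* From m a on, a * sqrt n >= 1, so that x ^ 2 <= n implies x <= a * n. *)
pose m (a : R) := Num.bound (a ^+ 2)^-1.
have mP a n : 0 < a -> (m a <= n)%N -> 1 <= a ^+ 2 * n%:R.
  move=> a0 mn; rewrite mulrC -ler_pdivrMr ?exprn_gt0 // mul1r.
  rewrite ltW // (lt_le_trans (archi_boundP _)) ?ler_nat //.
  by rewrite invr_ge0 exprn_ge0 // ltW.
apply: (whp_mono (n0 := maxn (maxn (Delta ^ 4) (150 * Delta)) (maxn (m delta) (m (eta / 4)))))
  hexp => n G; rewrite !geq_max => /andP[/andP[n1 n2] /andP[n3 n4]] /forallP rG [_ expand].
have reg x : rdeg (adj G) x = Delta by apply/eqP; exact: rG.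
exists (radius Delta n); split; [exact: radius_ge1|exact: radius_le|].
have edges_n : (2 * #|edges G| = Delta * n)%N.
  by rewrite -(card_edges reg) card_ord.
have sqr := ball_sqr hDelta n1.
have ball_small v : #|graph_ball G (radius Delta n) v|%:R <= delta * #|'I_n|%:R.
  rewrite card_ord; apply: le_trans (_ : ((radius Delta n).+1 * Delta ^ radius Delta n)%:R <= _).
    by rewrite ler_nat card_graph_ball.
  by apply: below_of_sqr => //; apply: mP.
have cluster_small : (Delta * (radius Delta n).+1)%:R <= eta / 2 * #|edges G|%:R.
  have h : (radius Delta n).+1%:R <= eta / 4 * n%:R.
    apply: below_of_sqr; rewrite ?divr_gt0 ?mP ?divr_gt0 //.
    by apply: leq_trans sqr; rewrite leq_exp2r // leq_pmulr // expn_gt0 D0.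
  have e : 2 * #|edges G|%:R = Delta%:R * n%:R :> R by rewrite -!natrM edges_n.
  have -> : eta / 2 * #|edges G|%:R = Delta%:R * (eta / 4 * n%:R).
    by rewrite mulrCA -e; field.
  by rewrite natrM ler_wpM2l.
apply: (wsm_of_marginals q1 beta0 _ (error_small R hDelta n1 (ltn0Sn _ : 0 < l)%N edges_n n2)).
move=> v e b ve; have := marginal_close q1 beta0 reg D0 expand t0 (decay_le1 R hDelta)
  eta0 eta_l eta_delta q_large beta_small ball_small cluster_small
  (cluster_rate_le1 R hDelta (ltn0Sn _ : 0 < l)%N) b ve.
by rewrite card_ord.
Qed.
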